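(* Let $p$ be a prime number. Then the following are equivalent. (1) $p=2$ or $p=3$. (2) There is a finite-dimensional $\mathbb{F}_p$-algebra whose unit group is an elementary abelian $2$-group. (3) The Tate cohomology functor $\hat{H}(C_p,-)$ is faithful on the stable module category of finitely generated $\mathbb{F}_pC_p$-modules.
   Context: Algebras are associative with identity. $C_p$ is the cyclic group of order $p$ and $\mathbb{F}_pC_p$ its group algebra over the field $\mathbb{F}_p$ with $p$ elements. An elementary abelian $2$-group is a direct sum of copies of $C_2$. The stable module category of finitely generated $\mathbb{F}_pC_p$-modules has as objects the finitely generated $\mathbb{F}_pC_p$-modules and as morphisms $\underline{\mathrm{Hom}}(M,N)$ the module homomorphisms $M\to N$ modulo those factoring through a projective module. The Tate cohomology functor sends $M$ to the graded group $\hat{H}(C_p,M)=\bigoplus_{i\in\mathbb{Z}}\hat{H}^i(C_p,M)$, with $\hat{H}^i(C_p,M)\cong\underline{\mathrm{Hom}}(\Omega^i\mathbb{F}_p,M)$, where $\mathbb{F}_p$ is the trivial module and $\Omega$ is the syzygy functor. Faithful means that a morphism in the stable category inducing the zero map on $\hat{H}(C_p,-)$ is zero in the stable category. *)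

(* Defs.v *)
From HB Require Import structures.
From mathcomp Require Import all_boot all_order all_algebra.
From mathcomp Require Import all_fingroup all_solvable all_field all_character.
From mathcomp Require Import ring_quotient generic_quotient boolp.

Set Implicit Arguments.
Unset Strict Implicit.
Unset Printing Implicit Defensive.

Import GRing.Theory.
Local Open Scope ring_scope.

(* A finitely generated module over the group algebra F[G] is a               *)
(* finite-dimensional representation of G, i.e., an object of type            *)
(* [representation F G].  Matrices act on row vectors on the right, so maps   *)
(* compose from left to right: [f *m g] is "f, then g".                       *)

Section Homomorphisms.

Variables (F : fieldType) (gT : finGroupType) (G : {group gT}).
Implicit Types M N L P : representation F G.

Definition intertwines M N (f : 'M[F]_(rdegree M, rdegree N)) : bool :=
  [forall x in G, M x *m f == f *m N x].

Lemma intertwinesP M N (f : 'M[F]_(rdegree M, rdegree N)) :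
  reflect {in G, forall x, M x *m f = f *m N x} (intertwines f).
Proof. exact: 'forall_in_eqP. Qed.

Lemma intertwines_zmod_closed M N : zmod_closed (@intertwines M N).
Proof.
split=> [|f g /intertwinesP fP /intertwinesP gP].
  by apply/intertwinesP=> x _; rewrite mulmx0 mul0mx.
by apply/intertwinesP=> x Gx; rewrite mulmxBr mulmxBl fP ?gP.
Qed.

HB.instance Definition _ M N :=
  GRing.isZmodClosed.Build _ (@intertwines M N) (intertwines_zmod_closed M N).

Record hom M N := Hom {
  hom_mx :> 'M[F]_(rdegree M, rdegree N);
  hom_intertwines : intertwines hom_mx }.

HB.instance Definition _ M N := [isSub for @hom_mx M N].
HB.instance Definition _ M N := [Choice of hom M N by <:].
HB.instance Definition _ M N := [SubChoice_isSubZmodule of hom M N by <:].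

Lemma homP M N (f : hom M N) : {in G, forall x, M x *m f = f *m N x}.
Proof. exact/intertwinesP/hom_intertwines. Qed.

Lemma hom_comp_subproof L M N (f : hom L M) (g : hom M N) :
  intertwines (f *m g).
Proof. by apply/intertwinesP=> x Gx; rewrite mulmxA homP // -!mulmxA homP. Qed.

Definition hom_comp L M N (f : hom L M) (g : hom M N) : hom L N :=
  Hom (hom_comp_subproof f g).

(* [row_full g] says that g is surjective.                                    *)
Definition projective P : Prop :=
  forall M N (g : hom M N), row_full g ->
  forall f : hom P N, exists h : hom P M, hom_comp h g = f.

Definition factors_through_projective M N (f : hom M N) : Prop :=
  exists (P : representation F G) (a : hom M P) (b : hom P N),
    projective P /\ f = hom_comp a b.

End Homomorphisms.

Section StableCategory.

Variables (F : fieldType) (gT : finGroupType) (G : {group gT}).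
Implicit Types M N L P : representation F G.

Lemma projective0 : projective (grepr0 : representation F G).
Proof.
move=> M N g _ f; have h0 : intertwines (0 : 'M[F]_(rdegree grepr0, rdegree M)).
  by apply/intertwinesP=> x _; rewrite mulmx0 mul0mx.
by exists (Hom h0); apply/val_inj/matrixP=> [[]].
Qed.

Lemma projective_dadd P Q :
  projective P -> projective Q -> projective (dadd_grepr P Q).
Proof.
move=> projP projQ M N g gfull [f fP].
pose fu : 'M[F]_(rdegree P, rdegree N) := usubmx f.
pose fd : 'M[F]_(rdegree Q, rdegree N) := dsubmx f.
have fE : f = col_mx fu fd by rewrite vsubmxK.
have fudP x : x \in G -> P x *m fu = fu *m N x /\ Q x *m fd = fd *m N x.
  move=> Gx; have := intertwinesP _ fP x Gx; rewrite fE /=.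
  by rewrite mul_block_col !mul0mx addr0 add0r mul_col_mx => /eq_col_mx.
have fuP x (Gx : x \in G) := (fudP x Gx).1.
have fdP x (Gx : x \in G) := (fudP x Gx).2.
have [hu /(congr1 val)/= huE] :=
  projP _ _ g gfull (Hom (introT (intertwinesP _) fuP)).
have [hd /(congr1 val)/= hdE] :=
  projQ _ _ g gfull (Hom (introT (intertwinesP _) fdP)).
have hP : @intertwines _ _ _ (dadd_grepr P Q) M (col_mx hu hd).
  apply/intertwinesP=> x Gx /=.
  by rewrite mul_block_col !mul0mx addr0 add0r mul_col_mx !homP.
by exists (Hom hP); apply: val_inj => /=; rewrite mul_col_mx huE hdE -fE.
Qed.

(* The homomorphisms factoring through a projective, as a subgroup of the     *)
(* Hom group.                                                                 *)
Definition proj_hom M N (f : hom M N) : bool :=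
  `[< factors_through_projective f >].

Lemma proj_hom_zmod_closed M N : zmod_closed (@proj_hom M N).
Proof.
split=> [|f g /asboolP[P [a [b [projP ->]]]] /asboolP[Q [c [d [projQ ->]]]]].
  apply/asboolP; exists grepr0, 0, 0; split; first exact: projective0.
  by apply: val_inj; rewrite /= mulmx0.
have acP : @intertwines _ _ _ M (dadd_grepr P Q) (row_mx a c).
  apply/intertwinesP=> x Gx /=.
  by rewrite mul_row_block !mulmx0 addr0 add0r mul_mx_row !homP.
have bdP : @intertwines _ _ _ (dadd_grepr P Q) N (col_mx b (- d)).
  apply/intertwinesP=> x Gx /=.
  by rewrite mul_block_col !mul0mx addr0 add0r mul_col_mx mulmxN mulNmx !homP.
apply/asboolP; exists (dadd_grepr P Q), (Hom acP), (Hom bdP).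
split; first exact: projective_dadd.
by apply: val_inj; rewrite /= mul_row_col mulmxN.
Qed.

HB.instance Definition _ M N :=
  GRing.isZmodClosed.Build _ (@proj_hom M N) (proj_hom_zmod_closed M N).

Definition proj_hom_subgroup M N : zmodClosed (hom M N) :=
  GRing.ZmodClosed.clone (hom M N) (@proj_hom M N) _.

Definition stable_hom M N : zmodType := {ideal_quot (proj_hom_subgroup M N)}.

Definition stable_class M N (f : hom M N) : stable_hom M N :=
  (\pi_(stable_hom M N) f)%qT.

Lemma stable_class_eq M N (f g : hom M N) :
  stable_class f = stable_class g <-> factors_through_projective (f - g).
Proof.
split=> [/eqP|fg].
  by rewrite -Quotient.idealrBE => /asboolP.
by apply/eqP; rewrite -Quotient.idealrBE; apply/asboolP.
Qed.

Definition stable_comp L M N (f : stable_hom L M) (g : stable_hom M N) :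
    stable_hom L N :=
  stable_class (hom_comp (repr f) (repr g)).

Lemma stable_class_repr M N (f : hom M N) :
  factors_through_projective (repr (stable_class f) - f).
Proof. by apply/stable_class_eq; rewrite /stable_class reprK. Qed.

Lemma stable_comp_class L M N (f : hom L M) (g : hom M N) :
  stable_comp (stable_class f) (stable_class g) = stable_class (hom_comp f g).
Proof.
apply/stable_class_eq.
have /asboolP fP := stable_class_repr f.
have /asboolP gP := stable_class_repr g.
set f' := repr _ in fP *; set g' := repr _ in gP *.
have -> : hom_comp f' g' - hom_comp f g =
    hom_comp (f' - f) g' + hom_comp f (g' - g).
  by apply: val_inj; rewrite /= mulmxBl mulmxBr addrA subrK.
apply/asboolP; apply: (@rpredD _ (proj_hom_subgroup L N)); apply/asboolP.
  have /asboolP[P [a [b [projP ->]]]] := fP.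
  exists P, a, (hom_comp b g'); split=> //.
  by apply: val_inj; rewrite /= mulmxA.
have /asboolP[P [a [b [projP ->]]]] := gP.
exists P, (hom_comp f a), b; split=> //.
by apply: val_inj; rewrite /= mulmxA.
Qed.

End StableCategory.

Section Tate.

Variables (F : fieldType) (gT : finGroupType) (G : {group gT}).
Implicit Types M N : representation F G.

Lemma trivial_mx_repr : mx_repr G (fun _ : gT => 1%:M : 'M[F]_1).
Proof. by split=> // x y _ _; rewrite mulmx1. Qed.

Definition trivial_module : representation F G :=
  Representation (MxRepresentation trivial_mx_repr).

Definition tensor M N : representation F G := Representation (prod_repr M N).

Definition regular_module : representation F G :=
  Representation (regular_repr F G).

(* F[G] (x) M with diagonal G-action is free (of rank dim M), since F[G] is.  *)
Definition free_hull M : representation F G := tensor regular_module M.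

(* F[G] -> F maps every group element to 1; F -> F[G] maps 1 to the sum of    *)
(* all the group elements.                                                    *)
Definition augmentation : 'M[F]_(rdegree regular_module, 1) := const_mx 1.
Definition norm_element : 'M[F]_(1, rdegree regular_module) := const_mx 1.

Lemma augmentationP :
  @intertwines _ _ _ regular_module trivial_module augmentation.
Proof.
apply/intertwinesP=> x Gx; apply/matrixP=> i j /=; rewrite mulmx1 !mxE.
rewrite (bigD1 (gring_index G (enum_val i * x)%g)) //= !mxE !eqxx mulr1.
by rewrite big1 ?addr0 // => k /negPf kP; rewrite !mxE eqxx kP mul0r.
Qed.

Lemma norm_elementP :
  @intertwines _ _ _ trivial_module regular_module norm_element.
Proof.
apply/intertwinesP=> x Gx; apply/matrixP=> i j /=; rewrite mul1mx !mxE.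
rewrite (bigD1 (gring_index G (enum_val j * x^-1)%g)) //= !mxE !eqxx /=.
rewrite gring_indexK ?groupM ?groupV ?enum_valP // mulgKV gring_valK eqxx mulr1.
rewrite big1 ?addr0 // => k kP; rewrite !mxE eqxx mul1r /=.
case: eqP => // jE; case/eqP: kP; rewrite jE gring_indexK.
  by rewrite mulgK gring_valK.
by rewrite groupM ?enum_valP.
Qed.

(* The degree of tensor trivial_module M is 1 * rdegree M: this is M, up to   *)
(* a cast of the dimension.                                                   *)
Definition cover_mx M : 'M[F]_(rdegree (free_hull M), 1 * rdegree M) :=
  tprod augmentation 1%:M.
Definition hull_mx M : 'M[F]_(1 * rdegree M, rdegree (free_hull M)) :=
  tprod norm_element 1%:M.

Lemma cover_mxP M :
  @intertwines _ _ _ (free_hull M) (tensor trivial_module M) (cover_mx M).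
Proof.
apply/intertwinesP=> x Gx; rewrite /= /cover_mx -!tprodE mulmx1 mul1mx.
by have /= -> := intertwinesP _ augmentationP x Gx.
Qed.

Lemma hull_mxP M :
  @intertwines _ _ _ (tensor trivial_module M) (free_hull M) (hull_mx M).
Proof.
apply/intertwinesP=> x Gx; rewrite /= /hull_mx -!tprodE mulmx1 !mul1mx.
by have /= := intertwinesP _ norm_elementP x Gx; rewrite mul1mx => <-.
Qed.

Lemma cover_kernel_module M : mxmodule (free_hull M) (kermx (cover_mx M)).
Proof.
apply/mxmoduleP=> x Gx; apply/sub_kermxP.
by rewrite -mulmxA (intertwinesP _ (cover_mxP M)) // mulmxA mulmx_ker mul0mx.
Qed.

Lemma hull_image_module M : mxmodule (free_hull M) <<hull_mx M>>%MS.
Proof.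
apply/mxmoduleP=> x Gx; rewrite genmxE (eqmxMr _ (genmxE _)).
by rewrite -(intertwinesP _ (hull_mxP M)) // submxMl.
Qed.

(* 0 -> syzygy M -> F[G] (x) M -> M -> 0                                      *)
Definition syzygy M : representation F G :=
  Representation (submod_repr (cover_kernel_module M)).

(* 0 -> M -> F[G] (x) M -> cosyzygy M -> 0                                    *)
Definition cosyzygy M : representation F G :=
  Representation (factmod_repr (hull_image_module M)).

Definition Omega (i : int) (M : representation F G) : representation F G :=
  match i with
  | Posz n => iter n syzygy M
  | Negz n => iter n.+1 cosyzygy M
  end.

(* The degree i component of the Tate cohomology of M, and its functoriality. *)
Definition tate (i : int) M : zmodType := stable_hom (Omega i trivial_module) M.

Definition tate_map (i : int) M N (f : stable_hom M N) (x : tate i M) :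
    tate i N :=
  stable_comp x f.

Definition tate_faithful : Prop :=
  forall M N (f : stable_hom M N),
    (forall (i : int) (x : tate i M), tate_map f x = 0) -> f = 0.

End Tate.

(* Main.v *)
Require Import Defs.
From mathcomp Require Import all_boot all_order all_algebra.
From mathcomp Require Import all_fingroup all_solvable all_field all_character.
From mathcomp Require Import zify.

(* Let g generate the group G of order p and put X = g - 1, so that           *)
(* F[G] = F[X]/X^p.  A homomorphism f : M -> N is stably zero iff             *)
(* f = \sum_(a + b = p - 1) X^a h X^b for some linear map h, iff f maps       *)
(* ker X^i into N X^(p - i) for all 0 < i < p.  If p <= 3 then only i = 1 and *)
(* i = p - 1 occur, and these two conditions are detected by Tate cohomology  *)
(* in degrees 0 and -1, since Omega^-1 F = F[X]/X^(p-1).                      *)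
(*   Conversely, X is a natural endomorphism of every module.  It is stably   *)
(* zero on the trivial module, and this property is inherited by syzygies and *)
(* cosyzygies, so X always acts as 0 on Tate cohomology.  If the latter is    *)
(* faithful, X is stably zero on F[X]/X^2, where X^a h X^b = 0 as soon as     *)
(* a + b >= 3; hence p - 1 < 3.                                               *)
(*   As for unit groups, 2 is a unit when p is odd, and 2 * 2 = 1 means that  *)
(* p divides 3.                                                               *)

(** The sum [conv] is, up to twisting h by an invertible matrix, the transfer of h from the trivial
    subgroup ([gconv_trace]). So a homomorphism is stably zero exactly when it is a value of [conv]
    ([stably_zeroP]), and [conv_kermx] and [conv_criterion] turn this into a condition on kernels
    and images of powers of X. For p < 4 only vectors killed by X or by X^(p-1) need testing. They
    correspond to maps from F and from Omega^-1 F ([invariants_probe], [coinvariants_probe]).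

    Conversely, chases along the sequences defining Omega ([stably_null_sub], [stably_null_quo])
    show that X is stably zero on each Omega^i F. By naturality X then kills all Tate cohomology,
    and the module [shear] bounds p through [faithful_square_zero_lt4]. *)

Section NilpotentOperators.

Set Implicit Arguments.
Unset Strict Implicit.
Unset Printing Implicit Defensive.

Import GRing.Theory.
Local Open Scope ring_scope.

Variable F : fieldType.

(** * The sums of A^a h B^b and the kernel-image criterion *)

Definition conv p m n (A : 'M[F]_m) (B : 'M[F]_n) (h : 'M[F]_(m, n)) :=
  \sum_(a < p) A ^+ a *m h *m B ^+ (p.-1 - a).

Lemma intertwine_exp m n (A : 'M[F]_m) (B : 'M[F]_n) f i :
  A *m f = f *m B -> A ^+ i *m f = f *m B ^+ i.
Proof.
move=> AfB; elim: i => [|i IHi]; first by rewrite !expr0 mul1mx mulmx1.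
by rewrite !exprSr -!mulmxE -mulmxA AfB !mulmxA IHi.
Qed.

Lemma mul_exp_eq0 m n (u : 'M[F]_(m, n)) (A : 'M[F]_n) i j :
  (i <= j)%N -> u *m A ^+ i = 0 -> u *m A ^+ j = 0.
Proof. by move=> /subnKC <- uA0; rewrite exprD -mulmxE mulmxA uA0 mul0mx. Qed.

Lemma convDr p m n (A : 'M[F]_m) (B : 'M[F]_n) h k :
  conv p A B (h + k) = conv p A B h + conv p A B k.
Proof.
rewrite -big_split; apply: eq_bigr => a _ /=.
by rewrite mulmxDr mulmxDl.
Qed.

Lemma conv_compl p l m n (A : 'M[F]_l) (B : 'M[F]_m) (C : 'M[F]_n) f h :
  A *m f = f *m B -> f *m conv p B C h = conv p A C (f *m h).
Proof.
move=> AfB; rewrite mulmx_sumr; apply: eq_bigr => a _.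
by rewrite !mulmxA (intertwine_exp _ AfB).
Qed.

Lemma conv_compr p l m n (A : 'M[F]_l) (B : 'M[F]_m) (C : 'M[F]_n) f h :
  B *m f = f *m C -> conv p A B h *m f = conv p A C (h *m f).
Proof.
move=> BfC; rewrite mulmx_suml; apply: eq_bigr => a _.
by rewrite -!mulmxA -(intertwine_exp _ BfC).
Qed.

(** Both products shift the sum by one index; the end terms left over contain A^p or B^p. *)
Lemma conv_intertwines p m n (A : 'M[F]_m) (B : 'M[F]_n) h :
  A ^+ p = 0 -> B ^+ p = 0 -> A *m conv p A B h = conv p A B h *m B.
Proof.
case: p => [|p] Ap Bp; first by rewrite /conv big_ord0 mulmx0 mul0mx.
have lE a C : A *m (A ^+ a *m h *m C) = A ^+ a.+1 *m h *m C.
  by rewrite exprS -mulmxE !mulmxA.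
have rE a b : A ^+ a *m h *m B ^+ b *m B = A ^+ a *m h *m B ^+ b.+1.
  by rewrite exprSr -mulmxE !mulmxA.
rewrite mulmx_sumr mulmx_suml big_ord_recr big_ord_recl /= lE rE.
rewrite Ap subn0 Bp mulmx0 !mul0mx addr0 add0r; apply: eq_bigr => a _.
by rewrite lE rE /= /bump leq0n add1n -subSn.
Qed.

(* On the kernel of A ^+ i only the terms with a < i survive. *)
Lemma conv_kermx p m n k (A : 'M[F]_m) (B : 'M[F]_n) h i (u : 'M[F]_(k, m)) :
  (i <= p)%N -> u *m A ^+ i = 0 -> (u *m conv p A B h <= B ^+ (p - i)%N)%MS.
Proof.
move=> le_ip uA0; rewrite mulmx_sumr summx_sub // => a _.
have [le_ia|lt_ai] := leqP i a.
  by rewrite !mulmxA (mul_exp_eq0 le_ia) // !mul0mx sub0mx.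
have -> : (p.-1 - a = (i.-1 - a) + (p - i))%N by lia.
by rewrite exprD -mulmxE !mulmxA submxMl.
Qed.

Lemma partial_inverse m n (A : 'M[F]_(m, n)) : exists A' : 'M_(n, m),
  forall k (u : 'M_(k, n)), (u <= A)%MS -> u *m A' *m A = u.
Proof. by exists (pinvmx A) => k u; apply: mulmxKpV. Qed.

(* With T the intersection of ker A and im A^i, the term of index i restricts *)
(* to f on ker A^(i+1), and the terms of index < i vanish there since f kills *)
(* ker A^i.                                                                   *)
Lemma conv_step p m n (A : 'M[F]_m) (B : 'M[F]_n) f i :
    (i < p)%N -> A *m f = f *m B ->
    (forall k (u : 'M[F]_(k, m)), u *m A ^+ i = 0 -> u *m f = 0) ->
    (forall k (u : 'M[F]_(k, m)), u *m A ^+ i.+1 = 0 ->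
       (u *m f <= B ^+ (p.-1 - i)%N)%MS) ->
  exists h, forall k (u : 'M[F]_(k, m)),
    u *m A ^+ i.+1 = 0 -> u *m conv p A B h = u *m f.
Proof.
move=> lt_ip AfB f_ker f_img.
pose T := (kermx A :&: A ^+ i)%MS.
have [T' TK] := partial_inverse T.
have [Ai AiK] := partial_inverse (A ^+ i).
have [Bi BiK] := partial_inverse (B ^+ (p.-1 - i)).
(* Project to T, divide by A^i, apply f, divide by B^(p-1-i). *)
exists (T' *m T *m Ai *m f *m Bi) => k u uA0.
rewrite mulmx_sumr (bigD1 (Ordinal lt_ip)) //= big1 => [|a]; last first.
  rewrite -val_eqE /= neq_ltn => /orP[lt_ai|lt_ia]; last first.
    by rewrite !mulmxA (mul_exp_eq0 lt_ia) // !mul0mx.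
  have -> : (p.-1 - a = (p.-1 - i) + (i - a))%N by have := ltn_ord a; lia.
  pose w := u *m A ^+ a *m T' *m T *m Ai.
  have wT : (w *m A ^+ i <= T)%MS.
    by rewrite AiK ?submxMl // (submx_trans (submxMl _ _)) ?capmxSr.
  have wA0 : w *m A ^+ i.+1 = 0.
    rewrite exprSr -mulmxE mulmxA; apply/sub_kermxP.
    exact: submx_trans wT (capmxSl _ _).
  rewrite exprD -mulmxE !mulmxA -/w BiK ?f_img // -mulmxA.
  rewrite -(intertwine_exp _ AfB) mulmxA f_ker // -mulmxA mulmxE -exprD.
  by apply: mul_exp_eq0 wA0; lia.
have uT : (u *m A ^+ i <= T)%MS.
  rewrite sub_capmx submxMl andbT; apply/sub_kermxP.
  by rewrite -mulmxA mulmxE -exprSr.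
have uf : u *m A ^+ i *m Ai *m f = u *m f.
  apply/eqP; rewrite -subr_eq0 -mulmxBl f_ker //.
  by rewrite mulmxBl AiK ?submxMl ?subrr.
by rewrite addr0 !mulmxA TK // uf BiK ?f_img.
Qed.

(** By induction on i, [conv_step] applied to the error f - [conv] h0 extends agreement with f from
    ker A^i to ker A^(i+1). At i = p the kernel is the whole space. *)
Lemma conv_criterion p m n (A : 'M[F]_m) (B : 'M[F]_n) f :
    A ^+ p = 0 -> B ^+ p = 0 -> A *m f = f *m B ->
    (forall i k (u : 'M[F]_(k, m)), (0 < i < p)%N ->
       u *m A ^+ i = 0 -> (u *m f <= B ^+ (p - i)%N)%MS) ->
  exists h, f = conv p A B h.
Proof.
move=> Ap Bp AfB f_img.
suff kill i : (i <= p)%N ->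
    exists h, forall k (u : 'M[F]_(k, m)),
      u *m A ^+ i = 0 -> u *m conv p A B h = u *m f.
  have [h hP] := kill p (leqnn p); exists h.
  by rewrite -[conv _ _ _ _]mul1mx hP mul1mx.
elim: i => [_|i IHi lt_ip].
  by exists 0 => k u; rewrite expr0 mulmx1 => ->; rewrite !mul0mx.
have [h0 h0P] := IHi (ltnW lt_ip).
have [||k u uA0|h1 h1P] := @conv_step p m n A B (f - conv p A B h0) i lt_ip.
- by rewrite mulmxBr mulmxBl AfB conv_intertwines.
- by move=> k u uA0; rewrite mulmxBr h0P ?subrr.
- rewrite mulmxBr -subn1 -subnDA add1n addmx_sub ?eqmx_opp ?conv_kermx //.
  (* The hypothesis covers i + 1 < p only; for i + 1 = p the target is the image of B^0. *)
  have [<-|nip] := eqVneq i.+1 p; first by rewrite subnn submx1.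
  by rewrite f_img //= ltn_neqAle nip.
exists (h0 + h1) => k u uA0.
by rewrite convDr mulmxDr h1P // mulmxBr addrCA subrr addr0.
Qed.

(** * Commutators and powers of A - 1 in characteristic p *)

Definition commutation m n (A : 'M[F]_m) (B : 'M[F]_n) (h : 'M[F]_(m, n)) :=
  h *m B - A *m h.

Lemma iter_commutation m n (A : 'M[F]_m) (B : 'M[F]_n) h k :
  iter k (commutation A B) h =
  \sum_(a < k.+1) ((-1) ^+ a * 'C(k, a)%:R) *: (A ^+ a *m h *m B ^+ (k - a)).
Proof.
elim: k => [|k IHk]; first by rewrite big_ord1 !mulr1 scale1r mul1mx mulmx1.
pose t a b := A ^+ a *m h *m B ^+ b; pose c k a : F := (-1) ^+ a * 'C(k, a)%:R.
have -> : iter k.+1 (commutation A B) h =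
    \sum_(a < k.+2) c k a *: t a (k.+1 - a)%N
      - \sum_(a < k.+1) c k a *: t a.+1 (k - a)%N.
  rewrite iterS {}IHk /commutation mulmx_suml mulmx_sumr; congr (_ - _).
    rewrite [RHS]big_ord_recr /= {2}/c bin_small // mulr0n mulr0 scale0r addr0.
    apply: eq_bigr => a _; rewrite -scalemxAl /t subSn -1?ltnS // exprSr.
    by rewrite -mulmxE !mulmxA.
  by apply: eq_bigr => a _; rewrite -scalemxAr /t exprS -mulmxE !mulmxA.
rewrite big_ord_recl [RHS]big_ord_recl /c !bin0 -addrA; congr (_ + _).
rewrite -sumrB; apply: eq_bigr => a _.
rewrite /= /bump leq0n add1n subSS -scalerBl binS natrD mulrDr; congr (_ *: _).
by rewrite exprS mulN1r -!mulNr.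
Qed.

Lemma bin_pred_pchar p a : p \in [pchar F] -> (a < p)%N ->
  (-1) ^+ a * 'C(p.-1, a)%:R = 1 :> F.
Proof.
move=> pF; have p_pr := pcharf_prime pF.
elim: a => [|a IHa] lt_ap; first by rewrite bin0 mulr1.
have : ('C(p, a.+1))%:R = 0 :> F.
  by apply/eqP; rewrite -(dvdn_pcharf pF) prime_dvd_bin.
rewrite -{1}(prednK (prime_gt0 p_pr)) binS natrD => /eqP.
rewrite addr_eq0 => /eqP ->.
by rewrite exprS mulN1r mulrNN IHa // ltnW.
Qed.

(* As 'C(p - 1, a) = (-1)^a modulo p, this is the expansion of the (p-1)st    *)
(* power of [h |-> h B - A h], which is invariant under translating A and B.  *)
Lemma conv_iter p m n (A : 'M[F]_m) (B : 'M[F]_n) h :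
  p \in [pchar F] -> conv p A B h = iter p.-1 (commutation A B) h.
Proof.
move=> pF; have p_gt0 := prime_gt0 (pcharf_prime pF).
rewrite iter_commutation prednK //; apply: eq_bigr => a _.
by rewrite bin_pred_pchar // scale1r.
Qed.

Lemma conv_sub1 p m n (A : 'M[F]_m) (B : 'M[F]_n) h : p \in [pchar F] ->
  conv p (A - 1) (B - 1) h = conv p A B h.
Proof.
move=> pF; rewrite !conv_iter //; apply: eq_iter => k.
rewrite /commutation mulmxBl mulmxBr mulmx1 mul1mx.
by rewrite opprB addrA subrK.
Qed.

Lemma conv0l p m n (B : 'M[F]_n) (h : 'M_(m, n)) :
  (0 < p)%N -> conv p 0 B h = h *m B ^+ p.-1.
Proof.
case: p => // p _; rewrite /conv big_ord_recl expr0 mul1mx subn0 /=.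
by rewrite big1 ?addr0 // => a _; rewrite exprS !mul0r !mul0mx.
Qed.

Lemma sub1_exp_pred_pchar p n (A : 'M[F]_n) :
  p \in [pchar F] -> (A - 1) ^+ p.-1 = \sum_(a < p) A ^+ a.
Proof.
move=> pF; have p_gt0 := prime_gt0 (pcharf_prime pF).
(* Write the left operator 0 as 1 - 1, so that translation by 1 gives the sum of the powers of A. *)
rewrite -[LHS]mul1mx -conv0l // -[0 in LHS](subrr 1) conv_sub1 //.
rewrite /conv (reindex_inj rev_ord_inj); apply: eq_bigr => a _ /=.
rewrite expr1n !mul1mx; congr (A ^+ _).
by have := ltn_ord a; lia.
Qed.

Lemma sub1_exp_pchar p n (A : 'M[F]_n) :
  p \in [pchar F] -> (A - 1) ^+ p = A ^+ p - 1.
Proof.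
case: n A => [|n] A pF; first by rewrite [LHS]flatmx0 [RHS]flatmx0.
have pM : p \in [pchar 'M[F]_n.+1].
  by rewrite (rmorph_pchar (@scalar_mx F n.+1)).
have := pFrobenius_autB_comm pM (commr1 A).
by rewrite pFrobenius_aut1 !pFrobenius_autE.
Qed.

(** * Kronecker products *)

Lemma tprodDl m1 n1 m2 n2 (A A' : 'M[F]_(m1, n1)) (B : 'M_(m2, n2)) :
  tprod (A + A') B = tprod A B + tprod A' B.
Proof.
elim: m1 A A' => [|m1 IHm] A A' /=; first by rewrite addr0.
by rewrite !linearD /= IHm add_col_mx -!trowbE linearD.
Qed.

Lemma tprod0l m1 n1 m2 n2 (B : 'M_(m2, n2)) :
  tprod (0 : 'M[F]_(m1, n1)) B = 0.
Proof. by apply: (addrI (tprod 0 B)); rewrite -tprodDl !addr0. Qed.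

Lemma tprod_suml (I : Type) (r : seq I) (P : pred I) m1 n1 m2 n2
    (A : I -> 'M[F]_(m1, n1)) (B : 'M_(m2, n2)) :
  tprod (\sum_(i <- r | P i) A i) B = \sum_(i <- r | P i) tprod (A i) B.
Proof.
apply: (big_morph (fun X => tprod X B)) => [X Y|]; first exact: tprodDl.
exact: tprod0l.
Qed.

Lemma tprod1l m n (A : 'M[F]_(m, n)) :
  castmx (mul1n m, mul1n n) (tprod 1%:M A) = A.
Proof.
apply/matrixP=> i j; rewrite castmxE /=.
have -> : cast_ord (esym (mul1n m)) i = lshift (0 * m) i by apply: val_inj.
have -> : cast_ord (esym (mul1n n)) j = lshift (0 * n) j by apply: val_inj.
by rewrite (@col_mxEu _ m (0 * m)) (@row_mxEl _ m n (0 * n)) !mxE mulr1n mul1r.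
Qed.

Definition unit_cast n : 'M[F]_(1 * n, n) := castmx (erefl, mul1n n) 1%:M.

Lemma unit_castP m n (A : 'M[F]_(m, n)) :
  tprod 1%:M A *m unit_cast n = unit_cast m *m A.
Proof.
rewrite -[A in RHS]tprod1l /unit_cast.
move: (mul1n m) (mul1n n) (tprod _ A); move: (1 * m)%N (1 * n)%N => m' n' em en.
by case: _ / em; case: _ / en => T; rewrite !castmx_id mul1mx mulmx1.
Qed.

Lemma unit_cast_free n : row_free (unit_cast n).
Proof.
rewrite /unit_cast; move: (mul1n n); move: (1 * n)%N => n' en.
by case: _ / en; rewrite castmx_id row_free_unit unitmx1.
Qed.

Lemma unit_cast_full n : row_full (unit_cast n).
Proof.
rewrite /unit_cast; move: (mul1n n); move: (1 * n)%N => n' en.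
by case: _ / en; rewrite castmx_id row_full_unit unitmx1.
Qed.

(** * Stable nullity of X along extensions *)

(* By [conv_criterion], this means that X is a stably zero endomorphism.      *)
Definition stably_null p n (X : 'M[F]_n) := forall a k (u : 'M_(k, n)),
  (a <= p)%N -> u *m X ^+ a = 0 -> (u *m X <= X ^+ (p - a)%N)%MS.

Section Extension.

Variables (p m n l : nat) (X : 'M[F]_m) (Y : 'M[F]_n) (Z : 'M[F]_l).
Variables (f : 'M[F]_(m, n)) (q : 'M[F]_(n, l)).
Hypotheses (Xf : X *m f = f *m Y) (Yq : Y *m q = q *m Z).
Hypotheses (f_free : row_free f) (q_full : row_full q).
Hypothesis exact_fq : forall k (u : 'M_(k, n)), (u <= f)%MS = (u *m q == 0).
Hypotheses (Yp : Y ^+ p = 0).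
Hypothesis Y_free : forall a k (u : 'M_(k, n)),
  (a <= p)%N -> u *m Y ^+ a = 0 -> (u <= Y ^+ (p - a)%N)%MS.

Let ker_q k (u : 'M_(k, n)) : u *m q = 0 -> exists v, u = v *m f.
Proof. by move/eqP; rewrite -exact_fq => /submxP. Qed.

Let fq k (u : 'M_(k, m)) : u *m f *m q = 0.
Proof. by apply/eqP; rewrite -exact_fq submxMl. Qed.

Let lift_q k (u : 'M_(k, l)) : exists v, u = v *m q.
Proof. by apply/submxP; rewrite submx_full. Qed.

Let Xfe i : X ^+ i *m f = f *m Y ^+ i := intertwine_exp i Xf.
Let Yqe i : Y ^+ i *m q = q *m Z ^+ i := intertwine_exp i Yq.

(** Freeness of Y gives u f = w Y^(p-a). Then w q lies in ker Z^(p-a), and nullity of Z yields z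
    with w Y - z Y^a = v f. Since Y^p = 0, this v satisfies u X = v X^(p-a). *)
Lemma stably_null_sub : stably_null p Z -> stably_null p X.
Proof.
move=> Zp a k u le_ap uXa.
have /submxP[w uE] : (u *m f <= Y ^+ (p - a)%N)%MS.
  by apply: Y_free => //; rewrite -mulmxA -Xfe mulmxA uXa mul0mx.
have wq0 : w *m q *m Z ^+ (p - a)%N = 0 by rewrite -mulmxA -Yqe mulmxA -uE fq.
have /submxP[z0] := Zp _ _ _ (leq_subr a p) wq0; rewrite subKn //.
have [z ->] := lift_q z0 => zE.
have [v vE] : exists v, w *m Y - z *m Y ^+ a = v *m f.
  by apply: ker_q; rewrite mulmxBl -!mulmxA Yq Yqe !mulmxA zE subrr.
apply/submxP; exists v; apply: (row_free_inj f_free).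
rewrite -mulmxA Xf mulmxA uE -!mulmxA Xfe (mulmxA v) -vE mulmxBl -!mulmxA.
by rewrite !mulmxE -exprD subnKC // Yp mulmx0 subr0 -exprS exprSr.
Qed.

(** The dual chase: u Y^a = v f with v in ker X^(p-a), nullity of X gives v X = w X^a, and freeness
    of Y applies to u Y - w f. *)
Lemma stably_null_quo : stably_null p X -> stably_null p Z.
Proof.
move=> Xp a k u0 le_ap; have [u ->] := lift_q u0 => uZa.
have [v vE] : exists v, u *m Y ^+ a = v *m f.
  by apply: ker_q; rewrite -mulmxA Yqe mulmxA.
have vX0 : v *m X ^+ (p - a)%N = 0.
  apply: (row_free_inj f_free); rewrite -mulmxA Xfe mulmxA -vE -mulmxA.
  by rewrite mulmxE -exprD subnKC // Yp mulmx0 mul0mx.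
have /submxP[w] := Xp _ _ _ (leq_subr a p) vX0; rewrite subKn // => wE.
have /submxP[z zE] : (u *m Y - w *m f <= Y ^+ (p - a)%N)%MS.
  apply: Y_free => //; rewrite mulmxBl -!mulmxA -Xfe (mulmxA w) -wE -mulmxA Xf.
  by rewrite (mulmxA v) -vE -!mulmxA !mulmxE -exprS exprSr subrr.
apply/submxP; exists (z *m q).
by rewrite -!mulmxA -Yqe -Yq !mulmxA -zE mulmxBl fq subr0.
Qed.

End Extension.

Lemma stably_null_iso p m n (X : 'M[F]_m) (Y : 'M[F]_n) c :
    X *m c = c *m Y -> row_free c -> row_full c ->
  stably_null p Y -> stably_null p X.
Proof.
move=> Xc c_free c_full Yp a k u le_ap uXa; have Xce i := intertwine_exp i Xc.
have ucY : u *m c *m Y ^+ a = 0 by rewrite -mulmxA -Xce mulmxA uXa mul0mx.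
have /submxP[w wE] := Yp _ _ _ le_ap ucY.
have /submxP[v vE] : (w <= c)%MS by rewrite submx_full.
apply/submxP; exists v; apply: (row_free_inj c_free).
by rewrite -!mulmxA Xc Xce !mulmxA wE vE.
Qed.

End NilpotentOperators.

(** * Modules over a cyclic group of order p *)

Section CyclicPrimeOrder.

Set Implicit Arguments.
Unset Strict Implicit.
Unset Printing Implicit Defensive.

Import GRing.Theory Defs.
Local Open Scope ring_scope.

Variables (F : fieldType) (gT : finGroupType) (G : {group gT}).
Variables (g : gT) (p : nat).
Hypotheses (defG : G :=: <[g]>%g) (ordg : #[g]%g = p) (pF : p \in [pchar F]).
Implicit Types M N P : representation F G.

Let Gg : g \in G. Proof. by rewrite defG cycle_id. Qed.

Let cardG : #|G| = p. Proof. by rewrite -ordg orderE -defG. Qed.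

Definition gsub1 M : 'M[F]_(rdegree M) := M g - 1%:M.

Lemma repr_expg M i : M (g ^+ i)%g = M g ^+ i.
Proof.
elim: i => [|i IHi]; first by rewrite expg0 repr_mx1 expr0.
by rewrite expgS repr_mxM ?groupX // IHi exprS mulmxE.
Qed.

Lemma gsub1_exp M : gsub1 M ^+ p = 0.
Proof.
by rewrite /gsub1 sub1_exp_pchar // -repr_expg -ordg expg_order repr_mx1 subrr.
Qed.

Lemma intertwines_gsub1 M N (f : 'M[F]_(rdegree M, rdegree N)) :
  reflect (gsub1 M *m f = f *m gsub1 N) (intertwines f).
Proof.
apply: (iffP (intertwinesP f)) => [fP|fP x Gx].
  by rewrite mulmxBl mulmxBr fP // mulmx1 mul1mx.
have /cycleP[i ->] : x \in <[g]>%g by rewrite -defG.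
rewrite !repr_expg; apply: intertwine_exp.
apply/eqP; move/eqP: fP.
by rewrite mulmxBl mulmxBr mulmx1 mul1mx (inj_eq (addIr _)).
Qed.

Definition gconv M N := conv p (gsub1 M) (gsub1 N).
Arguments gconv : clear implicits.

Lemma gconv_intertwines M N h : intertwines (gconv M N h).
Proof. by apply/intertwines_gsub1/conv_intertwines; apply: gsub1_exp. Qed.

(** Lift h through b as a linear map; [gconv] of the lift is a homomorphism. *)
Lemma gconv_lift M P N (f : hom M N) h (b : hom P N) : row_full b ->
  hom_mx f = gconv M N h -> exists a : hom M P, hom_comp a b = f.
Proof.
move=> b_full fE; exists (Hom (gconv_intertwines (h *m pinvmx b))).
have bP := intertwines_gsub1 _ (hom_intertwines b).
apply: val_inj; rewrite /= fE /gconv (conv_compr _ _ _ bP).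
by rewrite mulmxKpV ?submx_full.
Qed.

(** Higman's criterion: every f out of P is [gconv] of h f, hence lifts. *)
Lemma gconv_projective P h : 1%:M = gconv P P h -> projective P.
Proof.
move=> hP M N b b_full f; apply: (gconv_lift (h := h *m f)) => //.
have fP := intertwines_gsub1 _ (hom_intertwines f).
by rewrite -[LHS]mul1mx hP /gconv (conv_compr _ _ _ fP).
Qed.

Lemma gconv_trace M N h :
  gconv M N (h *m N (g ^- p.-1)%g) =
  \sum_(a < p) M (g ^+ a)%g *m h *m N (g ^- a)%g.
Proof.
rewrite /gconv conv_sub1 //; apply: eq_bigr => a _.
rewrite -!repr_expg -!mulmxA -repr_mxM ?groupV ?groupX //; do 2!congr (_ *m _).
congr (N _).
have le_ap : (a <= p.-1)%N by have := ltn_ord a; lia.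
by rewrite -{1}(subnK le_ap) expgD invMg mulgKV.
Qed.

(** * Freeness of hulls and stably zero maps *)

Lemma gring_index_eq x y : x \in G -> y \in G ->
  (gring_index G x == gring_index G y) = (x == y).
Proof.
by move=> Gx Gy; rewrite -(inj_eq (can_inj gring_valK)) !gring_indexK.
Qed.

Lemma expg_ord_inj : injective (fun a : 'I_p => g ^+ a)%g.
Proof.
move=> a b /eqP; rewrite eq_expg_mod_order ordg !modn_small //.
by move=> /eqP/val_inj.
Qed.

Lemma gring_index_bij (f : 'I_p -> gT) :
  (forall a, f a \in G) -> injective f -> bijective (gring_index G \o f).
Proof.
move=> Gf f_inj; apply: inj_card_bij; last by rewrite !card_ord cardG.
by move=> a b /eqP; rewrite /= gring_index_eq // => /eqP/f_inj.
Qed.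

(** E is the projection onto the coordinate of 1; its conjugates are the projections onto all
    coordinates. *)
Lemma regular_trace : exists E : 'M[F]_(rdegree (regular_module F G)),
  \sum_(a < p)
    regular_module F G (g ^+ a)%g *m E *m regular_module F G (g ^- a)%g = 1%:M.
Proof.
exists (delta_mx (gring_index G 1%g) (gring_index G 1%g)).
pose idx (a : 'I_p) := gring_index G (g ^- a)%g.
have idx_bij : bijective idx.
  apply: (@gring_index_bij (fun a => g ^- a)%g) => [a|a b].
    by rewrite groupV groupX.
  by move/invg_inj/expg_ord_inj.
rewrite mx1_sum_delta (reindex idx) /=; last exact: onW_bij.
apply: eq_bigr => a _; set i1 := gring_index G 1%g.
rewrite -(mul_delta_mx (0 : 'I_1)) mulmxA -mulmxA -colE -rowE /= rowK.
rewrite gring_indexK // mul1g -[RHS](mul_delta_mx (0 : 'I_1)); congr (_ *m _).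
apply/matrixP=> i j; rewrite ord1 !mxE eqxx andbT; congr ((nat_of_bool _)%:R).
rewrite -[i in RHS]gring_valK !gring_index_eq
  ?groupV ?groupX ?groupM ?enum_valP ?groupX //.
by rewrite eq_sym [RHS]eq_mulgV1 invgK.
Qed.

Lemma free_hull_conv M : exists h, gconv (free_hull M) (free_hull M) h = 1%:M.
Proof.
have [E EP] := regular_trace.
exists (tprod E 1%:M *m free_hull M (g ^- p.-1)%g); rewrite gconv_trace.
rewrite -[RHS]tprod1 -EP tprod_suml.
apply: eq_bigr => a _; rewrite /= -!tprodE mulmx1.
by rewrite -repr_mxM ?groupV ?groupX // mulgV repr_mx1.
Qed.

Lemma free_hull_projective M : projective (free_hull M).
Proof.
by have [h hP] := free_hull_conv M; apply: (gconv_projective (h := h)).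
Qed.

Lemma regular_augmentation :
  delta_mx 0 (gring_index G 1%g) *m augmentation F G = 1%:M.
Proof.
by apply/matrixP=> i j; rewrite !ord1 -rowE !mxE.
Qed.

Lemma norm_regular :
  norm_element F G *m delta_mx (gring_index G 1%g) 0 = 1%:M.
Proof.
by apply/matrixP=> i j; rewrite !ord1 -colE !mxE.
Qed.

Lemma cover_mx_full M : row_full (cover_mx M).
Proof.
apply/row_fullP.
exists (tprod (delta_mx 0 (gring_index G 1%g)) 1%:M : 'M_(1 * _, _)).
by rewrite /cover_mx -tprodE regular_augmentation mul1mx tprod1.
Qed.

Lemma hull_mx_free M : row_free (hull_mx M).
Proof.
apply/row_freeP.
exists (tprod (delta_mx (gring_index G 1%g) 0) 1%:M : 'M_(_, 1 * _)).
by rewrite /hull_mx -tprodE norm_regular mul1mx tprod1.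
Qed.

Lemma free_hull_onto M : exists c : hom (free_hull M) M, row_full c.
Proof.
have cP : @intertwines _ _ _ (free_hull M) M (cover_mx M *m unit_cast F _).
  apply/intertwinesP=> x Gx; rewrite mulmxA (intertwinesP _ (cover_mxP M)) //.
  by rewrite -!mulmxA unit_castP.
exists (Hom cP); apply/row_fullP.
have /row_fullP[s sP] := cover_mx_full M.
have /row_fullP[t tP] := unit_cast_full F (rdegree M).
by exists (t *m s); rewrite /= mulmxA -(mulmxA t) sP mulmx1.
Qed.

Lemma stably_zeroP M N (f : hom M N) :
  factors_through_projective f <-> exists h, hom_mx f = gconv M N h.
Proof.
split=> [[P [a [b [projP ->]]]] | [h fE]]; last first.
  have [c c_full] := free_hull_onto N.
  have [a <-] := gconv_lift c_full fE.
  by exists (free_hull N), a, c; split=> //; apply: free_hull_projective.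
have [c c_full] := free_hull_onto P.
have id_P : @intertwines _ _ _ P P 1%:M.
  by apply/intertwinesP=> x _; rewrite mulmx1 mul1mx.
have [s /(congr1 val)/= sc] := projP _ _ c c_full (Hom id_P).
have [h hP] := free_hull_conv P.
have cbP := intertwines_gsub1 _ (hom_intertwines (hom_comp c b)).
have asP := intertwines_gsub1 _ (hom_intertwines (hom_comp a s)).
(* P is a summand of its free hull via s and c, and the identity of the hull is [gconv] of h. *)
exists (a *m s *m (h *m (c *m b))).
rewrite /gconv -(conv_compl _ _ _ asP) -(conv_compr _ _ _ cbP).
by rewrite [conv _ _ _ _]hP mul1mx /= !mulmxA -(mulmxA a) sc mulmx1.
Qed.

Lemma stably_zero_kermx M N (f : hom M N) i k (u : 'M_(k, _)) :
    factors_through_projective f -> (i <= p)%N -> u *m gsub1 M ^+ i = 0 ->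
  (u *m f <= gsub1 N ^+ (p - i)%N)%MS.
Proof. by case/stably_zeroP=> h -> le_ip; apply: conv_kermx. Qed.

Lemma stably_zero_criterion M N (f : hom M N) :
    (forall i k (u : 'M_(k, _)), (0 < i < p)%N -> u *m gsub1 M ^+ i = 0 ->
       (u *m f <= gsub1 N ^+ (p - i)%N)%MS) ->
  factors_through_projective f.
Proof.
move=> f_img; apply/stably_zeroP.
apply: conv_criterion => //; try exact: gsub1_exp.
exact/intertwines_gsub1/hom_intertwines.
Qed.

(** * The operator X in the stable category *)

Lemma stable_class_onto M N (x : stable_hom M N) : exists f, x = stable_class f.
Proof.
exists (generic_quotient.repr x).
by rewrite /stable_class generic_quotient.reprK.
Qed.

Lemma stable_class_eq0 M N (f : hom M N) :
  stable_class f = 0 <-> factors_through_projective f.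
Proof.
have <- : stable_class (0 : hom M N) = 0 by apply: raddf0.
by rewrite stable_class_eq subr0.
Qed.

Lemma gsub1_intertwines M : @intertwines _ _ _ M M (gsub1 M).
Proof. exact/intertwines_gsub1. Qed.

Definition gsub1_hom M : hom M M := Hom (gsub1_intertwines M).

Lemma gsub1_hom_stably_zero M :
  stably_null p (gsub1 M) -> factors_through_projective (gsub1_hom M).
Proof.
move=> null_M; apply: stably_zero_criterion => i k u /andP[_ lt_ip].
exact/null_M/ltnW.
Qed.

Lemma gsub1_trivial : gsub1 (trivial_module F G) = 0.
Proof. by rewrite /gsub1 /= subrr. Qed.

Lemma free_hull_kermx M a k (u : 'M_(k, _)) : (a <= p)%N ->
    u *m gsub1 (free_hull M) ^+ a = 0 ->
  (u <= gsub1 (free_hull M) ^+ (p - a)%N)%MS.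
Proof.
have [h hP] := free_hull_conv M; move=> le_ap uX0.
by rewrite -[u]mulmx1 -hP; apply: conv_kermx.
Qed.

Lemma unit_cast_iso M :
  gsub1 (tensor (trivial_module F G) M) *m unit_cast F (rdegree M) =
  unit_cast F (rdegree M) *m gsub1 M.
Proof. by rewrite mulmxBl mulmxBr mulmx1 mul1mx unit_castP. Qed.

Lemma stably_null_tensor_trivial M :
  stably_null p (gsub1 M) ->
  stably_null p (gsub1 (tensor (trivial_module F G) M)).
Proof.
apply: stably_null_iso (unit_cast_iso M) _ _; last exact: unit_cast_full.
exact: unit_cast_free.
Qed.

Lemma stably_null_syzygy M :
  stably_null p (gsub1 M) -> stably_null p (gsub1 (syzygy M)).
Proof.
move=> /stably_null_tensor_trivial.
apply: (stably_null_sub (Y := gsub1 (free_hull M)) (f := val_submod 1%:M)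
  (q := cover_mx M)).
- rewrite mulmxBl mul1mx mulmxBr mulmx1 -val_submodE -[X in val_submod X]mul1mx.
  by rewrite val_submodJ.
- by have /intertwines_gsub1 := cover_mxP M.
- by rewrite /row_free val_submod1.
- exact: cover_mx_full.
- by move=> k u; rewrite val_submod1; apply/sub_kermxP/eqP.
- exact: gsub1_exp.
- exact: free_hull_kermx.
Qed.

Lemma stably_null_cosyzygy M :
  stably_null p (gsub1 M) -> stably_null p (gsub1 (cosyzygy M)).
Proof.
move=> /stably_null_tensor_trivial.
apply: (stably_null_quo (Y := gsub1 (free_hull M)) (f := hull_mx M)
  (q := in_factmod _ 1%:M)).
- by have /intertwines_gsub1 := hull_mxP M.
- rewrite mulmxBl mul1mx mulmxBr mulmx1 -in_factmodE -in_factmodJ //.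
  by rewrite mul1mx.
- exact: hull_mx_free.
- apply/row_fullP; exists (val_factmod 1%:M).
  by rewrite -in_factmodE val_factmodK.
- by move=> k u; rewrite -in_factmodE in_factmod_eq0 genmxE.
- exact: gsub1_exp.
- exact: free_hull_kermx.
Qed.

Lemma stably_null_Omega i :
  stably_null p (gsub1 (Omega i (trivial_module F G))).
Proof.
have null_triv : stably_null p (gsub1 (trivial_module F G)).
  by move=> a k u _ _; rewrite gsub1_trivial mulmx0 sub0mx.
case: i => [n|n]; rewrite /Omega.
  elim: n => //= n; apply: stably_null_syzygy.
elim: {n}n.+1 => // n; exact: stably_null_cosyzygy.
Qed.

Lemma faithful_gsub1_stably_zero M :
  tate_faithful F G -> factors_through_projective (gsub1_hom M).
Proof.
move=> faithful; apply/stable_class_eq0/faithful => i x.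
have [y ->] := stable_class_onto x.
rewrite /tate_map stable_comp_class; apply/stable_class_eq0.
have [P [a [b [projP abE]]]] := gsub1_hom_stably_zero (@stably_null_Omega i).
(* By naturality, y followed by X on M is X on Omega^i F followed by y. *)
exists P, a, (hom_comp b y); split=> //; apply: val_inj => /=.
rewrite mulmxA -[a *m b]/(val (hom_comp a b)) -abE /=.
by rewrite [RHS](intertwines_gsub1 _ (hom_intertwines y)).
Qed.

Lemma faithful_square_zero_lt4 M : tate_faithful F G ->
  gsub1 M ^+ 2 = 0 -> gsub1 M != 0 -> (p < 4)%N.
Proof.
move=> /(@faithful_gsub1_stably_zero M)/stably_zeroP[h hE] M2.
rewrite ltnNge; apply: contra_neqN => p4; rewrite [LHS]hE /gconv.
apply: big1 => a _; have [a2|a_lt2] := leqP 2 a.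
  by rewrite -(subnKC a2) exprD M2 mul0r !mul0mx.
have /subnKC <- : (2 <= p.-1 - a)%N by lia.
by rewrite exprD M2 mul0r mulmx0.
Qed.

(** * Detection in degrees 0 and -1 *)

Section Probes.

Variables (M N : representation F G) (f : hom M N).
Hypothesis f_tate0 :
  forall (i : int) (x : tate i M), tate_map (stable_class f) x = 0.

Lemma tate0_probe (i : int) (x : hom (Omega i (trivial_module F G)) M) :
  factors_through_projective (hom_comp x f).
Proof.
by apply/stable_class_eq0; rewrite -stable_comp_class; apply: f_tate0.
Qed.

Lemma invariants_probe (v : 'rV_(rdegree M)) :
  v *m gsub1 M = 0 -> (v *m f <= gsub1 N ^+ p.-1)%MS.
Proof.
move=> vX0; have vP : @intertwines _ _ _ (trivial_module F G) M v.
  by apply/intertwines_gsub1; rewrite gsub1_trivial mul0mx vX0.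
have := stably_zero_kermx (i := 1) (u := 1%:M) (tate0_probe (i := 0) (Hom vP)).
rewrite subn1 /= !mul1mx; apply; first exact: prime_gt0 (pcharf_prime pF).
by rewrite gsub1_trivial.
Qed.

Let U := <<hull_mx (trivial_module F G)>>%MS.
Let H := free_hull (trivial_module F G).
Let e : 'rV[F]_(rdegree H) :=
  tprod (delta_mx (0 : 'I_1) (gring_index G 1%g)) (1%:M : 'M_1).

Lemma hull_generatorM x : e *m H x =
  tprod (delta_mx (0 : 'I_1) (gring_index G 1%g) *m regular_mx F G x)
    (1%:M : 'M_1).
Proof.
have := tprodE (delta_mx (0 : 'I_1) (gring_index G 1%g)) (regular_mx F G x)
  (1%:M : 'M_1) (1%:M : 'M_1).
by rewrite mulmx1 => ->.
Qed.

Lemma hull_generator_socle :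
  e *m gsub1 H ^+ p.-1 = hull_mx (trivial_module F G).
Proof.
rewrite sub1_exp_pred_pchar // mulmx_sumr /hull_mx.
have -> : norm_element F G =
    \sum_(a < p) delta_mx 0 (gring_index G 1%g) *m regular_mx F G (g ^+ a)%g.
  pose idx (a : 'I_p) := gring_index G (g ^+ a)%g.
  have idx_bij : bijective idx.
    by apply: gring_index_bij expg_ord_inj => a; rewrite groupX.
  transitivity (\sum_j delta_mx 0 j : 'rV[F]_#|G|).
    apply/rowP=> j; rewrite mxE summxE (bigD1 j) //= mxE !eqxx big1 ?addr0 //.
    by move=> k /negPf kj; rewrite mxE eq_sym kj andbF.
  rewrite (reindex idx) /=; last exact: onW_bij.
  by apply: eq_bigr => a _; rewrite -rowE rowK gring_indexK // mul1g.
rewrite tprod_suml; apply: eq_bigr => a _.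
by rewrite -repr_expg hull_generatorM.
Qed.

(** H is free on e, so e can be sent to v; the norm element e X^(p-1) then goes to v X^(p-1) = 0. *)
Lemma hull_lift (v : 'rV_(rdegree M)) : v *m gsub1 M ^+ p.-1 = 0 ->
  exists E : hom H M, e *m E = v /\ hull_mx (trivial_module F G) *m E = 0.
Proof.
move=> vX0; have p_gt0 := prime_gt0 (pcharf_prime pF).
pose d : 'M[F]_(rdegree H, 1) :=
  tprod (delta_mx (gring_index G 1%g) (0 : 'I_1)) (1%:M : 'M_1).
have dE (u : 'rV[F]_#|G|) :
    tprod u (1%:M : 'M_1) *m d =
    tprod (u *m delta_mx (gring_index G 1%g) (0 : 'I_1)) (1%:M : 'M_1).
  have := tprodE u (delta_mx (gring_index G 1%g) (0 : 'I_1))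
    (1%:M : 'M_1) (1%:M : 'M_1).
  by rewrite mulmx1 => ->.
(* Since d reads the coordinate at 1, only the term a = 0 of the transfer of d v survives on e. *)
pose h := d *m v *m M (g ^- p.-1)%g.
exists (Hom (@gconv_intertwines H M h)); split=> /=.
  rewrite gconv_trace mulmx_sumr (bigD1 (Ordinal p_gt0)) // big1 => [|a a0].
    rewrite /= expg0 invg1 !repr_mx1 mulmx1 addr0 tprod1 mul1mx mulmxA.
    rewrite dE mul_delta_mx [delta_mx 0 0](_ : _ = 1%:M) ?tprod1.
      exact: mul1mx.
    by apply/matrixP=> i j; rewrite !ord1 !mxE.
  rewrite !mulmxA hull_generatorM -rowE rowK gring_indexK // mul1g dE.
  rewrite mul_delta_mx_0 ?tprod0l ?mul0mx //.
  rewrite gring_index_eq ?groupX //; apply: contra a0 => /eqP ga1.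
  by apply/eqP/expg_ord_inj; rewrite /= ga1 expg0.
have hullP := intertwines_gsub1 _ (hull_mxP (trivial_module F G)).
rewrite /gconv (conv_compl _ _ _ hullP).
have -> : gsub1 (tensor (trivial_module F G) (trivial_module F G)) = 0.
  by apply/eqP; rewrite subr_eq0; apply/eqP; apply: tprod1.
rewrite conv0l // /h !mulmxA -mulmxA.
have xX := intertwinesP _ (gsub1_intertwines M) (g ^- p.-1)%g.
rewrite -(intertwine_exp _ (esym (xX _))) ?groupV ?groupX // mulmxA.
by rewrite -!(mulmxA _ v) vX0 !(mulmx0, mul0mx).
Qed.

(** As E kills the norm element, it factors through the cosyzygy of F, where the class of e is
    killed by X^(p-1) and maps to v. *)
Lemma coinvariants_probe (v : 'rV_(rdegree M)) :
  v *m gsub1 M ^+ p.-1 = 0 -> (v *m f <= gsub1 N)%MS.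
Proof.
case/hull_lift=> E [eE hullE].
pose C := cosyzygy (trivial_module F G).
(* A linear section followed by E; its choice is immaterial because E vanishes on U. *)
pose x : 'M_(rdegree C, rdegree M) := val_factmod 1%:M *m E.
have in_x k (u : 'M_(k, _)) : in_factmod U u *m x = u *m E.
  rewrite -[in RHS](add_sub_fact_mod U u) mulmxDl mulmxA -val_factmodE.
  have /submxP[w ->] :
      (val_submod (in_submod U u) <= hull_mx (trivial_module F G))%MS.
    by rewrite -(genmxE (hull_mx _)) val_submodP.
  by rewrite -mulmxA hullE mulmx0 add0r.
have xP : @intertwines _ _ _ C M x.
  apply/intertwinesP=> y Gy.
  rewrite /= /factmod_mx in_x -mulmxA (intertwinesP _ (hom_intertwines E)) //.
  by rewrite mulmxA.
have gsub1C k i (u : 'M_(k, _)) :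
    in_factmod U u *m gsub1 C ^+ i = in_factmod U (u *m gsub1 H ^+ i).
  elim: i k u => [|i IHi] k u; first by rewrite !expr0 !mulmx1.
  rewrite !exprS -!mulmxE !mulmxA -IHi; congr (_ *m _).
  by rewrite mulmxBr [in RHS]mulmxBr !mulmx1 linearB /= -in_factmodJ.
have := stably_zero_kermx (M := C) (i := p.-1) (u := in_factmod U e)
  (tate0_probe (i := Negz 0) (Hom xP)).
rewrite /= mulmxA in_x eE; have -> : (p - p.-1 = 1)%N.
  by have := prime_gt0 (pcharf_prime pF); lia.
apply; first exact: leq_pred.
apply/eqP; rewrite [_ *m _]gsub1C hull_generator_socle in_factmod_eq0 genmxE.
exact: submx_refl.
Qed.

End Probes.

Lemma tate_faithful_lt4 : (p < 4)%N -> tate_faithful F G.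
Proof.
move=> p_lt4 M N f0; have [f ->] := stable_class_onto f0 => f_tate0.
apply/stable_class_eq0/stably_zero_criterion => i k u i_p uX0.
apply/row_subP=> j; rewrite row_mul.
have vX0 : row j u *m gsub1 M ^+ i = 0 by rewrite -row_mul uX0 row0.
(* The indices 1 and p - 1 coincide when p = 2. *)
have [i1|i1] := eqVneq i 1%N.
  by move: vX0; rewrite i1 expr1 subn1; apply: invariants_probe.
have iE : i = p.-1 by move: i_p i1 p_lt4; lia.
have -> : (p - i = 1)%N by move: i_p i1 p_lt4; lia.
by rewrite expr1; move: vX0; rewrite iE; apply: coinvariants_probe.
Qed.

End CyclicPrimeOrder.

(** * Prime fields: a test module and unit groups *)

Section PrimeField.

Set Implicit Arguments.
Unset Strict Implicit.
Unset Printing Implicit Defensive.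

Import GRing.Theory Defs.
Local Open Scope ring_scope.

Variable p : nat.
Hypothesis p_pr : prime p.

Let pF : p \in [pchar 'F_p]. Proof. by rewrite pchar_Fp. Qed.

(** This is F[X]/X^2, the generator acting as 1 + X. *)
Definition shear_mx (x : 'Z_p) : 'M['F_p]_2 := 1%:M + x%:R *: delta_mx 0 1.

Lemma shear_mx_repr : mx_repr [set: 'Z_p]%G shear_mx.
Proof.
split=> [|x y _ _]; first by rewrite /shear_mx mulr0n scale0r addr0.
rewrite /shear_mx mulmxDl !mul1mx mulmxDr mulmx1 -scalemxAl -scalemxAr.
rewrite mul_delta_mx_0 // !scaler0 addr0 -addrA -scalerDl -natrD addnC.
congr (_ + _ *: _); rewrite -[RHS](GRing.natr_mod_pchar pF) /=.
congr ((_ %% _)%:R).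
exact: Zp_cast (prime_gt1 p_pr).
Qed.

Definition shear : representation 'F_p [set: 'Z_p]%G :=
  Representation (MxRepresentation shear_mx_repr).

Lemma Zp_generator : [set: 'Z_p]%G :=: <[Zp1 : 'Z_p]>%g.
Proof. exact: Zp_cycle. Qed.

Lemma order_Zp_generator : #[Zp1 : 'Z_p]%g = p.
Proof. by rewrite orderE -Zp_cycle cardsT card_ord Zp_cast ?prime_gt1. Qed.

Lemma tate_faithful_Zp : tate_faithful 'F_p [set: 'Z_p]%G <-> (p < 4)%N.
Proof.
split=> [faithful|]; last first.
  exact: tate_faithful_lt4 Zp_generator order_Zp_generator pF.
have shear_gsub1 : gsub1 (Zp1 : 'Z_p) shear = delta_mx 0 1.
  rewrite /gsub1 /= /shear_mx addrC addKr.
  by rewrite /= modn_small ?scale1r.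
apply: (faithful_square_zero_lt4 Zp_generator order_Zp_generator pF
  (M := shear)) => //.
  by rewrite shear_gsub1 expr2 -mulmxE mul_delta_mx_0.
rewrite shear_gsub1; apply/eqP=> /matrixP/(_ 0 1); rewrite !mxE /= => /eqP.
by rewrite oner_eq0.
Qed.

Lemma abelem_units_lt4 (A : falgType 'F_p) :
  (2.-abelem [set: {unit finvect_type A}])%g -> p = 2%N \/ p = 3%N.
Proof.
case/abelemP=> // _ sq1; have [->|p2] := eqVneq p 2%N; [by left|right].
have two_unit : (2%:R : finvect_type A) \is a GRing.unit.
  have -> : 2%:R = in_alg A 2%:R by rewrite rmorph_nat.
  apply: rmorph_unit; rewrite unitfE -(dvdn_pcharf pF).
  by rewrite dvdn_prime2.
have := sq1 (FinRing.unit _ two_unit) (in_setT _).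
move=> /(congr1 val) /= two_sq.
have three0 : 3%:R = 0 :> finvect_type A.
  by apply: (addIr 1); rewrite add0r -[RHS]two_sq -natrM natr1.
(* The structure map [in_alg] is injective, so 3 vanishes already in F_p. *)
have : in_alg A 3%:R = 0 by rewrite rmorph_nat.
move/eqP; rewrite fmorph_eq0 -(dvdn_pcharf pF) dvdn_prime2 //.
by move/eqP.
Qed.

Lemma Fp_units_abelem : (p < 4)%N ->
  (2.-abelem [set: {unit finvect_type ('F_p)^o}])%g.
Proof.
have sq1 (w : 'F_p) : w \is a GRing.unit -> (p < 4)%N -> w * w = 1.
  move=> w_unit p_lt4; have w0 : w != 0.
    by apply: contraTneq w_unit => ->; rewrite unitr0.
  have : p = 2%N \/ p = 3%N by have := prime_gt1 p_pr; lia.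
  case=> pE; move: w w0 {w_unit}; rewrite pE.
    by case=> [[|[|?]] ?] //= _; apply: val_inj.
  by case=> [[|[|[|?]]] ?] //= _; apply: val_inj.
move=> p_lt4; apply/abelemP=> //; split=> [|x _].
  by apply/centsP=> x _ y _; apply: val_inj; apply: (@mulrC 'F_p).
apply: val_inj; apply: sq1 => //.
exact: valP x.
Qed.

End PrimeField.

Theorem corollary1p2 (p : nat) (hp : prime p) :
  [<-> p = 2 \/ p = 3;
       exists A : falgType 'F_p, (2.-abelem [set: {unit finvect_type A}])%g;
       tate_faithful 'F_p [set: 'Z_p]%G].
Proof.
(* The bound p < 4 is the form of the first condition used by the lemmas. *)
have lt4 : p < 4 <-> p = 2 \/ p = 3.
  by have := prime_gt1 hp; lia.
split=> [/lt4 p_lt4|]; first by exists (('F_p)^o)%R; apply: Fp_units_abelem.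
split=> [[A /(abelem_units_lt4 hp)/lt4]|]; first by move/(tate_faithful_Zp hp).
by move/(tate_faithful_Zp hp)/lt4.
Qed.
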